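(* Let $R$ be an associative ring with unit and let $M$ be a left $R$-module which is projective in $\sigma[M]$ and has finite uniform dimension. The following conditions are equivalent: 1. $M$ is a semiprime module and $M$ is non $M$-singular. 2. $M$ is a semiprime module and satisfies the ascending chain condition on left annihilators in $M$. 3. For every submodule $N\leq M$: $N$ is essential in $M$ if and only if there exists a monomorphism $f:M\rightarrow N$.
   Context: Modules are unitary left $R$-modules. $\sigma[M]$ is the smallest full subcategory of $R$-Mod containing all modules isomorphic to a submodule of an $M$-generated module (a quotient of a direct sum of copies of $M$). $M$ is projective in $\sigma[M]$ if every morphism $M\to N$ lifts along every epimorphism $L\to N$ in $\sigma[M]$. For submodules $K,L\leq M$, $K_ML=\sum\{f(K)\mid f\in Hom_R(M,L)\}$. A submodule $K\le M$ is fully invariant if $f(K)\le K$ for all $f\in End_R(M)$. $M$ is a semiprime module if for every fully invariant submodule $K\leq M$, $K_MK=0$ implies $K=0$. A module $N\in\sigma[M]$ is $M$-singular if there is an exact sequence $0\to K\to L\to N\to 0$ in $\sigma[M]$ with $K$ essential in $L$. Every $L\in\sigma[M]$ has a largest $M$-singular submodule $\mathcal{Z}(L)$; $L$ is non $M$-singular if $\mathcal{Z}(L)=0$. A left annihilator in $M$ is a submodule of the form $\mathcal{A}_X=\bigcap\{Ker(f)\mid f\in X\}$ for some $X\subseteq End_R(M)$. *)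

(* Defs.v *)
From HB Require Import structures.
From mathcomp Require Import all_boot all_algebra.
From mathcomp Require Import boolp classical_sets functions cardinality.

Set Implicit Arguments.
Unset Strict Implicit.
Unset Printing Implicit Defensive.

Import GRing.Theory.
Local Open Scope classical_set_scope.
Local Open Scope ring_scope.

(* [submodClosed V] is a boolean predicate, but under the classical axioms of
   [boolp] every submodule of [V], given as a [set V], is one of these. *)
Section SubmoduleType.
Context {R : pzRingType} {V : lmodType R}.

Record submod (N : submodClosed V) :=
  Submod { submod_val : V; submod_valP : submod_val \in N }.

Section Instances.
Variable N : submodClosed V.
HB.instance Definition _ := [isSub for @submod_val N].
HB.instance Definition _ := [Choice of submod N by <:].
HB.instance Definition _ := [SubChoice_isSubLmodule of submod N by <:].
End Instances.
End SubmoduleType.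

Section DirectSum.
Context {R : pzRingType}.

Definition fin_supp (I : Type) (M : lmodType R) : {pred I -> M} :=
  fun f => `[< finite_set [set i | f i != 0] >].

Section Instances.
Variables (I : Type) (M : lmodType R).

Fact fin_supp_submod_closed : subsemimod_closed (@fin_supp I M).
Proof.
split; [split |].
- apply/asboolP; rewrite (_ : [set _ | _] = set0); first exact: finite_set0.
  by apply/seteqP; split=> i //=; rewrite eqxx.
- move=> f g /asboolP finf /asboolP fing; apply/asboolP.
  apply: (@sub_finite_set _ _ ([set i | f i != 0] `|` [set i | g i != 0])).
    move=> i /= fgi; case: (eqVneq (f i) 0) => [fi0|]; last by left.
    right; apply: contra_neq fgi => gi0.
    by rewrite [LHS](_ : _ = f i + g i) // fi0 gi0 addr0.
  by rewrite finite_setU.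
- move=> a f /asboolP finf; apply/asboolP; apply: sub_finite_set finf.
  move=> i /=; apply: contra_neq => fi0.
  by rewrite [LHS](_ : _ = a *: f i) // fi0 scaler0.
Qed.

(* The direct sum of copies of [M] indexed by [I]. *)
Record copies :=
  Copies { copies_val : I -> M; copies_valP : copies_val \in @fin_supp I M }.
HB.instance Definition _ := [isSub for copies_val].
HB.instance Definition _ := [Choice of copies by <:].
HB.instance Definition _ :=
  GRing.SubChoice_isSubLmodule.Build R (I -> M) (@fin_supp I M) copies
    fin_supp_submod_closed.
End Instances.
End DirectSum.

Section ModuleNotions.
Context {R : pzRingType}.
Implicit Types M N L V : lmodType R.

Definition generated_by M N : Prop :=
  exists (I : Type) (p : {linear copies I M -> N}), set_surj setT setT p.

(* [in_sigma M N]: the module [N] is an object of sigma[M]. *)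
Definition in_sigma M N : Prop :=
  exists (G : lmodType R) (i : {linear N -> G}), generated_by M G /\ injective i.

Definition projective_in_sigma M : Prop :=
  forall (L N : lmodType R) (g : {linear L -> N}) (f : {linear M -> N}),
    in_sigma M L -> in_sigma M N -> set_surj setT setT g ->
    exists h : {linear M -> L}, forall x, g (h x) = f x.

(* Meant for sets [A] that are submodules of [V]. *)
Definition essential V (A : set V) : Prop :=
  forall H : submodClosed V, A `&` [set` H] = [set 0] -> [set` H] = [set 0].

(* The family is indexed by an arbitrary type; [s] ranges over its finite
   duplicate-free selections of indices. *)
Definition independent V (I : eqType) (A : I -> submodClosed V) : Prop :=
  forall (s : seq I) (x : I -> V), uniq s -> (forall i, x i \in A i) ->
    \sum_(i <- s) x i = 0 -> forall i, i \in s -> x i = 0.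

(* No infinite direct sum of nonzero submodules. *)
Definition finite_uniform_dimension V : Prop :=
  ~ exists A : nat -> submodClosed V,
      (forall n, [set` A n] <> [set 0]) /\ independent A.

(* K_M L, the sum of the images f(K) over all f in Hom(M, L). *)
Definition mprod M (K L : submodClosed M) : set M :=
  [set x | exists (n : nat) (f : 'I_n -> {linear M -> submod L}) (k : 'I_n -> M),
     (forall i, k i \in K) /\ x = \sum_(i < n) val (f i (k i))].

Definition fully_invariant M (K : submodClosed M) : Prop :=
  forall (f : {linear M -> M}) x, x \in K -> f x \in K.

Definition semiprime M : Prop :=
  forall K : submodClosed M, fully_invariant K ->
    mprod K K = [set 0] -> [set` K] = [set 0].

Definition M_singular M N : Prop :=
  exists (K L : lmodType R) (i : {linear K -> L}) (p : {linear L -> N}),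
    [/\ in_sigma M K, in_sigma M L & in_sigma M N] /\
    [/\ injective i, set_surj setT setT p,
        range i = [set x | p x = 0] & essential (range i)].

Definition largest_M_singular M L (Z : submodClosed L) : Prop :=
  M_singular M (submod Z) /\
  forall K : submodClosed L, M_singular M (submod K) -> [set` K] `<=` [set` Z].

Definition non_M_singular M L : Prop :=
  exists Z : submodClosed L, largest_M_singular M Z /\ [set` Z] = [set 0].

Definition annihilator M (X : set {linear M -> M}) : set M :=
  \bigcap_(f in X) [set x | f x = 0].

Definition acc_left_annihilators M : Prop :=
  forall A : nat -> set M,
    (forall n, exists X : set {linear M -> M}, A n = annihilator X) ->
    (forall n, A n `<=` A n.+1) ->
    exists n0, forall n, (n0 <= n)%N -> A n = A n0.

End ModuleNotions.

(* Main.v *)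
(* Semiprimeness, with projectivity, gives for every nonzero K <= M some
   f : M -> K with f(K) <> 0.
   (1 => 3) If K is uniform such an f is injective on K by nonsingularity;
   choosing uniform submodules successively in N and in the kernels of the
   previous maps gives an independent family, so after finitely many steps the
   sum of the maps is a monomorphism M -> N.  Conversely, if f : M -> N is mono
   and H meets N trivially, then H, f(H), f^2(H), ... are independent.
   (3 => 1) With C a complement of K, project a monomorphism M -> K + C to g :
   M -> K.  If K is fully invariant with K_M K = 0 then g(K) = 0, so K lies in C.
   If K is M-singular then ker g is essential, and M -> ker g -> C is mono, so C
   is essential.
   (1 => 2) By nonsingularity a left annihilator is never essential in a larger
   one, so a strictly ascending chain yields an infinite direct sum.
   (2 => 1) Endomorphisms with essential kernel vanish: take a nonzero one with
   maximal kernel and apply semiprimeness to its image. *)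
Require Import Defs.
From HB Require Import structures.
From mathcomp Require Import all_boot all_algebra.
From mathcomp Require Import boolp classical_sets functions cardinality.
From mathcomp Require Import finmap fsbigop.

Set Implicit Arguments.
Unset Strict Implicit.
Unset Printing Implicit Defensive.

Import GRing.Theory.
Local Open Scope classical_set_scope.
Local Open Scope ring_scope.

(** * Calculus of submodules: images, kernels, intersections, sums *)

Section Submodules.
Context {R : pzRingType}.
Implicit Types U V : lmodType R.

Definition submod_set V (A : set V) : Prop :=
  [/\ A 0, forall x y, A x -> A y -> A (x + y) & forall a x, A x -> A (a *: x)].

(** Keeping the closure proof [cA] in the term lets the [submodClosed] structure be inferred from
    the predicate itself. *)
Definition set_pred V (A : set V) (cA : submod_set A) : {pred V} :=
  fun x => `[< A x >].

Fact set_pred_closed V (A : set V) (cA : submod_set A) :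
  GRing.subsemimod_closed (set_pred cA).
Proof.
case: (cA) => A0 AD AZ; split; [split|]; first exact/asboolP.
- by move=> x y /asboolP Ax /asboolP Ay; apply/asboolP/AD.
- by move=> a x /asboolP Ax; apply/asboolP/AZ.
Qed.

HB.instance Definition _ V (A : set V) (cA : submod_set A) :=
  GRing.isSubmodClosed.Build R V (set_pred cA) (set_pred_closed cA).

Lemma set_predP V (A : set V) (cA : submod_set A) x :
  x \in set_pred cA <-> A x.
Proof. by split => /asboolP. Qed.

Lemma submodN V (A : submodClosed V) x : x \in A -> - x \in A.
Proof. by move=> Ax; rewrite -scaleN1r; exact: rpredZ. Qed.

Lemma submodB V (A : submodClosed V) x y : x \in A -> y \in A -> x - y \in A.
Proof. by move=> Ax Ay; apply: rpredD => //; exact: submodN. Qed.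

Fact full_submod V : submod_set [set: V].
Proof. by []. Qed.

Definition full V : submodClosed V := set_pred (@full_submod V).

Fact zero_submod V : submod_set [set 0 : V].
Proof. by split=> [//|x y /= -> ->|a x /= ->]; rewrite ?addr0 ?scaler0. Qed.

Definition zero V : submodClosed V := set_pred (@zero_submod V).

Fact limage_submod U V (f : {linear U -> V}) (K : submodClosed U) :
  submod_set [set f x | x in [set` K]].
Proof.
split; first by exists 0; rewrite ?linear0 //=; exact: rpred0.
- move=> _ _ [x Kx <-] [y Ky <-]; exists (x + y); last exact: linearD.
  exact: rpredD.
- by move=> a _ [x Kx <-]; exists (a *: x); [exact: rpredZ | exact: linearZ].
Qed.

Definition limage U V (f : {linear U -> V}) (K : submodClosed U) :
  submodClosed V := set_pred (limage_submod f K).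

Fact lker_submod U V (f : {linear U -> V}) : submod_set [set x | f x = 0].
Proof.
split=> [|x y|a x] /=; first exact: linear0.
- by rewrite linearD => -> ->; rewrite addr0.
- by rewrite linearZ => -> /=; rewrite scaler0.
Qed.

Definition lker U V (f : {linear U -> V}) : submodClosed U :=
  set_pred (lker_submod f).

Fact meet_submod V (A B : submodClosed V) :
  submod_set [set x | x \in A /\ x \in B].
Proof.
split=> [|x y|a x] /=; first by split; exact: rpred0.
- by move=> [Ax Bx] [Ay By]; split; exact: rpredD.
- by move=> [Ax Bx]; split; exact: rpredZ.
Qed.

Definition meet V (A B : submodClosed V) : submodClosed V :=
  set_pred (meet_submod A B).

Fact join_submod V (A B : submodClosed V) :
  submod_set [set x | exists2 a, a \in A & x - a \in B].
Proof.
split=> [|x y|c x] /=; first by exists 0; rewrite ?subr0; exact: rpred0.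
- move=> [a Aa Bxa] [b Ab Byb]; exists (a + b); first exact: rpredD.
  by rewrite opprD addrACA; exact: rpredD.
- move=> [a Aa Bxa]; exists (c *: a); first exact: rpredZ.
  by rewrite -scalerBr; exact: rpredZ.
Qed.

Definition join V (A B : submodClosed V) : submodClosed V :=
  set_pred (join_submod A B).

Lemma mem_full V (x : V) : x \in full V.
Proof. exact/set_predP. Qed.

Lemma mem_limage U V (f : {linear U -> V}) (K : submodClosed U) x :
  x \in K -> f x \in limage f K.
Proof. by move=> Kx; apply/set_predP; exists x. Qed.

Lemma mem_lker U V (f : {linear U -> V}) x : x \in lker f <-> f x = 0.
Proof. exact: set_predP. Qed.

Lemma subset_joinl V (A B : submodClosed V) : {subset A <= join A B}.
Proof.
by move=> x Ax; apply/set_predP; exists x; rewrite // subrr; exact: rpred0.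
Qed.

Lemma subset_joinr V (A B : submodClosed V) : {subset B <= join A B}.
Proof.
by move=> x Bx; apply/set_predP; exists 0; rewrite ?subr0 //; exact: rpred0.
Qed.

Definition trivial V (K : submodClosed V) : Prop := forall x, x \in K -> x = 0.

Definition disj V (A B : submodClosed V) : Prop :=
  forall x, x \in A -> x \in B -> x = 0.

Definition essential_in V (A B : submodClosed V) : Prop :=
  forall H : submodClosed V, {subset H <= B} -> disj A H -> trivial H.

Lemma trivialP V (K : submodClosed V) : [set` K] = [set 0] <-> trivial K.
Proof.
split=> [K0 x Kx|K0]; first by have : [set` K] x by []; rewrite K0.
by apply/seteqP; split=> x /=; [exact: K0 | move=> ->; exact: rpred0].
Qed.

Lemma essentialP V (N : submodClosed V) :
  essential [set` N] <-> essential_in N (full V).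
Proof.
split=> [eN H _ dH|eN H NH0]; last first.
  apply/trivialP; apply: eN => [x _|x Nx Hx]; first exact: mem_full.
  by have : ([set` N] `&` [set` H]) x by []; rewrite NH0.
apply/trivialP; apply: eN; apply/seteqP; split=> x /= => [[]|->]; first exact: dH.
by split; exact: rpred0.
Qed.

Lemma limage_trivial U V (f : {linear U -> V}) (K : submodClosed U) :
  trivial (limage f K) <-> forall x, x \in K -> f x = 0.
Proof.
split=> [t x Kx|fK _ /set_predP[x Kx <-]]; last exact: fK.
exact/t/mem_limage.
Qed.

Lemma linear_fun U V (f : U -> V) :
  linear f -> exists g : {linear U -> V}, g =1 f.
Proof.
move=> lf; pose m := GRing.isLinear.Build R U V *:%R f lf.
by pose g : {linear U -> V} := HB.pack f m; exists g.
Qed.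

Lemma corestrict U V (f : {linear U -> V}) (N : submodClosed V) :
  (forall x, f x \in N) ->
  exists g : {linear U -> submod N}, forall x, submod_val (g x) = f x.
Proof.
move=> fN; have [|g gE] := @linear_fun U (submod N) (fun x => Submod (fN x)).
  by move=> a x y; apply: val_inj; rewrite /= linearP.
by exists g => x; rewrite gE.
Qed.

(** Projection of [f] onto the first summand. Any choice of components is linear, because its
    linearity defect lies in both [A] and [B]. *)
Lemma join_split U V (f : {linear U -> V}) (A B : submodClosed V) :
  disj A B -> (forall x, f x \in join A B) ->
  exists g : {linear U -> V}, forall x, g x \in A /\ f x - g x \in B.
Proof.
move=> dAB fAB; have {}fAB x : exists a, a \in A /\ f x - a \in B.
  by have /set_predP[a] := fAB x; exists a.
have [k kP] := choice fAB.
have [|g gE] := @linear_fun U V k; last by exists g => x; rewrite gE.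
move=> a x y; apply/eqP; rewrite -subr_eq0; apply/eqP; apply: dAB.
  have [[[Ax _] [Ay _]] [Az _]] := (kP x, kP y, kP (a *: x + y)).
  by apply: submodB => //; apply: rpredD => //; exact: rpredZ.
have [[[_ Bx] [_ By]] [_ Bz]] := (kP x, kP y, kP (a *: x + y)).
rewrite (_ : _ - _ = (a *: (f x - k x) + (f y - k y))
                     - (f (a *: x + y) - k (a *: x + y))).
  by apply: submodB => //; apply: rpredD => //; exact: rpredZ.
by rewrite linearP scalerBr addrACA -opprD opprB [RHS]addrC addrA subrK.
Qed.

End Submodules.

(** * Finite uniform dimension as a termination principle *)

Section UniformDimension.
Context {R : pzRingType} {V : lmodType R}.
Implicit Types (A : nat -> submodClosed V) (H K N U : submodClosed V).

(** In a vanishing sum the pivot term lies in [A i] and, being minus the sum of the others, in [B];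
    so it is zero and can be removed from [s]. *)
Lemma independent_pivot A :
    (forall s : seq nat, s != [::] -> exists i B, [/\ i \in s, disj (A i) B &
       forall j, j \in s -> j != i -> {subset A j <= B}]) ->
  independent A.
Proof.
move=> piv s x + xA; have [n] := ubnP (size s).
elim: n => // n IHn in s *; rewrite ltnS => sn us s0.
case: (eqVneq s [::]) => [-> //|/piv[i [B [si dAB AB]]]].
rewrite (perm_big _ (perm_to_rem si)) big_cons /= in s0.
have srem j : j \in rem i s -> (j \in s) && (j != i).
  by rewrite mem_rem_uniq // inE andbC.
have xi0 : x i = 0.
  apply: dAB => //; rewrite -(addrK (\sum_(j <- rem i s) x j) (x i)) s0 sub0r.
  rewrite -scaleN1r; apply: rpredZ; rewrite big_seq; apply: rpred_sum => j /srem/andP[sj ji].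
  exact: AB (xA j).
move=> j sj; case: (eqVneq j i) => [-> //|ji].
apply: (IHn (rem i s)); rewrite ?rem_uniq ?mem_rem_uniq ?inE ?ji //.
- by rewrite size_rem // (leq_trans _ sn) // ltn_predL lt0n size_eq0; case: (s) si.
- by rewrite xi0 add0r in s0.
Qed.

Lemma min_mem (s : seq nat) :
  s != [::] -> exists2 i, i \in s & forall j, j \in s -> (i <= j)%N.
Proof.
case: s => // a s _; have ex : exists n, n \in a :: s by exists a; exact: mem_head.
by case: (ex_minnP ex) => i si mi; exists i.
Qed.

Lemma max_mem (s : seq nat) :
  s != [::] -> exists2 i, i \in s & forall j, j \in s -> (j <= i)%N.
Proof.
case: s => // a s _; have ex : exists n, n \in a :: s by exists a; exact: mem_head.
have ub n : n \in a :: s -> (n <= \max_(i <- a :: s) i)%N.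
  by move=> sn; apply: (@leq_bigmax_seq _ (a :: s) xpredT id).
by case: (ex_maxnP ex ub) => i si mi; exists i.
Qed.

Lemma chain_choice (T : Type) (P : T -> Prop)
    (Q : T -> submodClosed V -> T -> Prop) :
    (forall t, P t -> exists t' H, P t' /\ Q t H t') ->
  forall t, P t -> exists (u : nat -> T) (A : nat -> submodClosed V),
    forall n, Q (u n) (A n) (u n.+1).
Proof.
move=> step t Pt; pose X := ({t | P t} * submodClosed V)%type.
pose Rel (x y : X) := Q (sval x.1) y.2 (sval y.1).
have stepX x : {y : X | Rel x y}.
  apply: cid; case: x => -[t1 Pt1] K.
  by have [t' [H [Pt' QH]]] := step _ Pt1; exists (exist _ t' Pt', H).
have [u [_ uR]] := dependent_choice stepX (exist _ t Pt, full V).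
(* Each pair stores the submodule produced by the step leading to it, hence the shift; the initial
   [full V] is never read. *)
by exists (fun n => sval (u n).1), (fun n => (u n.+1).2).
Qed.

Hypothesis fud : finite_uniform_dimension V.

(** An endless run would produce submodules [H], each avoiding the next [D], which contains all
    later ones. They are independent, with the least index as pivot. *)
Lemma fud_descent (T : Type) (P : T -> Prop) (D : T -> submodClosed V) :
    (forall t, P t -> exists t' H, P t' /\ [/\ ~ trivial H, {subset H <= D t},
       {subset D t' <= D t} & disj H (D t')]) ->
  forall t, ~ P t.
Proof.
move=> step t /(chain_choice step)[u [A uA]]; apply: fud; exists A; split.
  by move=> n /trivialP; have [] := uA n.
have Dmono m n : (m <= n)%N -> {subset D (u n) <= D (u m)}.
  elim: n => [|n IHn]; first by rewrite leqn0 => /eqP ->.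
  rewrite leq_eqVlt ltnS => /predU1P[-> //|/IHn nm] x.
  by have [_ _ D' _] := uA n; move/D'/nm.
apply: independent_pivot => s /min_mem[i si mi]; exists i, (D (u i.+1)).
split=> //; first by have [] := uA i.
move=> j sj ji x; have [_ AD _ _] := uA j; move/AD; apply: Dmono.
by rewrite ltn_neqAle eq_sym ji mi.
Qed.

(** Dual to [fud_descent]: each [H] avoids the current [D], which contains all earlier ones, so the
    greatest index is the pivot. *)
Lemma fud_ascent (T : Type) (P : T -> Prop) (D : T -> submodClosed V) :
    (forall t, P t -> exists t' H, P t' /\ [/\ ~ trivial H, {subset H <= D t'},
       {subset D t <= D t'} & disj H (D t)]) ->
  forall t, ~ P t.
Proof.
move=> step t /(chain_choice step)[u [A uA]]; apply: fud; exists A; split.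
  by move=> n /trivialP; have [] := uA n.
have Dmono m n : (m <= n)%N -> {subset D (u m) <= D (u n)}.
  elim: n => [|n IHn]; first by rewrite leqn0 => /eqP ->.
  rewrite leq_eqVlt ltnS => /predU1P[-> //|/IHn mn] x.
  by have [_ _ D' _] := uA n; move/mn/D'.
apply: independent_pivot => s /max_mem[i si mi]; exists i, (D (u i)).
split=> //; first by have [] := uA i.
move=> j sj ji x; have [_ AD _ _] := uA j; move/AD; apply: Dmono.
by rewrite ltn_neqAle ji mi.
Qed.

Definition uniform U : Prop :=
  ~ trivial U /\ forall A B : submodClosed V, {subset A <= U} ->
    {subset B <= U} -> disj A B -> trivial A \/ trivial B.

(** A nonzero submodule that is not uniform contains two disjoint nonzero ones; descend to one and
    discard the other. *)
Lemma uniform_exists K :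
  ~ trivial K -> exists2 U, uniform U & {subset U <= K}.
Proof.
move=> nK; apply: contrapT => noU.
pose P H := ~ trivial H /\ {subset H <= K}.
apply: (@fud_descent _ P id _ K); last by split.
move=> H [nH HK]; have : ~ uniform H by move=> uH; apply: noU; exists H.
move=> nuH; apply: contrapT => nstep; apply: nuH; split=> // A B AH BH dAB.
apply: contrapT => /not_orP[nA nB]; apply: nstep; exists B, A; split=> //.
by split=> // x /BH/HK.
Qed.

(** Starting from zero, [C] absorbs any nonzero [H] that avoids [K + C]; the sums [K + C] cannot
    grow forever. *)
Lemma complement_exists K :
  exists2 C, disj K C & essential_in (join K C) (full V).
Proof.
apply: contrapT => noC.
apply: (@fud_ascent _ (disj K) (join K) _ (zero V)); last by move=> x _ /set_predP.
move=> C dC; apply: contrapT => nstep; apply: noC; exists C => // H _ dH.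
apply: contrapT => nH; apply: nstep; exists (join C H), H; split.
  move=> x Kx /set_predP[c Cc Hxc]; have xc0 : x - c = 0.
    apply: dH Hxc; apply: submodB; first exact: subset_joinl.
    exact: subset_joinr.
  by apply: dC => //; rewrite (subr0_eq xc0).
split=> //.
- by move=> x Hx; do 2 apply: subset_joinr.
- move=> x /set_predP[k Kk Cxk]; apply/set_predP; exists k => //.
  exact: subset_joinl.
- by move=> x Hx KCx; exact: dH.
Qed.

Lemma injective_essential (f : {linear V -> V}) :
  injective f -> essential_in (limage f (full V)) (full V).
Proof.
move=> injf H _ dH; apply: contrapT => nH.
(* Passing from [g] to [g \o f] splits off [g(H)], disjoint from the image of [g \o f]; from the
   identity this yields [H], [f(H)], [f(f(H))] and so on. *)
pose D (g : {linear V -> V}) := limage g (full V).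
apply: (@fud_descent _ (fun g : {linear V -> V} => injective g) D _ idfun) => //.
move=> g injg; exists (g \o f : {linear V -> V}), (limage g H).
split; first exact: inj_comp.
split.
- move=> /limage_trivial gH0; apply: nH => x Hx.
  by apply: injg; rewrite linear0 gH0.
- by move=> _ /set_predP[x _ <-]; exact/mem_limage/mem_full.
- by move=> _ /set_predP[x _ <-]; exact/mem_limage/mem_full.
- move=> _ /set_predP[x Hx <-] /set_predP[y _ /injg fyx].
  by rewrite (dH x) ?linear0 // -fyx; exact/mem_limage/mem_full.
Qed.

End UniformDimension.

(** * The category sigma[M], lifting of maps, and M-singularity *)

Section Sigma.
Context {R : pzRingType} {M : lmodType R}.
Implicit Types (f g h : {linear M -> M}) (H K N : submodClosed M).

Lemma in_sigma_inj (N : lmodType R) (i : {linear N -> M}) :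
  injective i -> in_sigma M N.
Proof.
move=> injI; exists M, i; split=> //.
have [|p pE] := @linear_fun _ (copies unit M) M (fun phi => copies_val phi tt).
  by move=> a phi psi.
exists unit, p => y _.
have fs : (fun=> y) \in @fin_supp R unit M.
  by apply/asboolP; apply: sub_finite_set (finite_set1 tt) => -[].
by exists (Copies fs); rewrite // pE.
Qed.

Lemma in_sigma_self : in_sigma M M.
Proof. by apply: (@in_sigma_inj _ (idfun : {linear M -> M})) => x y. Qed.

Lemma in_sigma_submod N : in_sigma M (submod N).
Proof. exact: (@in_sigma_inj _ (val : {linear submod N -> M}) val_inj). Qed.

Lemma in_sigma_copies (I : Type) (N : submodClosed (copies I M)) :
  in_sigma M (submod N).
Proof.
exists (copies I M), (val : {linear submod N -> copies I M}).
split; last exact: val_inj.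
exists I, (idfun : {linear copies I M -> copies I M}).
by move=> y _; exists y.
Qed.

Section CopiesSum.
Variables (I : choiceType) (E : I -> {linear M -> M}).

(** The map out of the direct sum induced by the family [E]; the sum over all of [I] is a finitely
    supported one. *)
Definition copies_sum (phi : copies I M) : M :=
  \sum_(i \in [set: I]) E i (copies_val phi i).

Lemma copies_sumE (phi : copies I M) (D : set I) : finite_set D ->
    [set i | copies_val phi i != 0] `<=` D ->
  copies_sum phi = \sum_(i <- fset_set D) E i (copies_val phi i).
Proof.
move=> finD subD; rewrite -fsbig_finite //; apply/esym/fsbig_widen => // i [_ Di].
apply: contrapT => Ei; apply: Di; apply: subD; apply/eqP => phi0.
by apply: Ei; rewrite /= phi0 linear0.
Qed.

Lemma copies_sum_linear : linear copies_sum.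
Proof.
move=> a phi psi; have /asboolP fphi := copies_valP phi.
have /asboolP fpsi := copies_valP psi.
pose D := [set i | copies_val phi i != 0] `|` [set i | copies_val psi i != 0].
have finD : finite_set D by rewrite finite_setU.
rewrite (@copies_sumE phi D) //; last by move=> i; left.
rewrite (@copies_sumE psi D) //; last by move=> i; right.
rewrite (@copies_sumE _ D) //; last first.
  move=> i; apply: contraPP => nD; apply/negP; rewrite negbK.
  have -> : copies_val (a *: phi + psi) i =
            a *: copies_val phi i + copies_val psi i by [].
  have /not_orP[/negP + /negP] := nD; rewrite !negbK => /eqP -> /eqP ->.
  by rewrite scaler0 addr0.
rewrite scaler_sumr -big_split; apply: eq_bigr => i _.
exact: (linearP (E i) a).
Qed.

Lemma copies_sum_single (i : I) (x : M) :
  exists2 phi : copies I M, copies_sum phi = E i x &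
    forall j, copies_val phi j = x \/ copies_val phi j = 0.
Proof.
pose d j := if j == i then x else 0.
have fd : d \in @fin_supp R I M.
  apply/asboolP; apply: sub_finite_set (finite_set1 i) => j /=.
  by rewrite /d; case: (j =P i) => [-> //|_]; rewrite eqxx.
exists (Copies fd); last by move=> j; rewrite /= /d; case: (j =P i); [left|right].
rewrite /copies_sum -(@fsbig_widen _ _ _ _ [set i]) // => [|j [_ /= /eqP ji]].
  by rewrite fsbig_set1 /= /d eqxx.
by rewrite /= /d; case: (j =P i) ji => // _ _; rewrite linear0.
Qed.

End CopiesSum.

Hypothesis M_proj : projective_in_sigma M.

(** Projectivity needs an epimorphism, so both maps are first corestricted to the image of [g]. *)
Lemma lift_factor f g :
  (forall x, exists y, g y = f x) -> exists h, forall x, g (h x) = f x.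
Proof.
move=> fg; have gN x : g x \in limage g (full M) by exact/mem_limage/mem_full.
have fN x : f x \in limage g (full M) by have [y <-] := fg x.
have [[f' fE] [g' gE]] := (corestrict fN, corestrict gN).
have [|||h hE] := M_proj (g := g') f'.
- exact: in_sigma_self.
- exact: in_sigma_submod.
- move=> [y Ny] _; have /set_predP[x _ xy] := Ny.
  by exists x => //; apply: val_inj; rewrite /= gE.
- by exists h => x; rewrite -gE hE fE.
Qed.

(* The fully invariant hull of [K] is the image, under the sum map, of a module
   of finitely supported families in [K]; projectivity lifts any [f : M -> hull]
   to such families, and each coordinate of the lift maps [M] into [K]. *)
Lemma semiprime_kill K : semiprime M ->
    (forall f, (forall x, f x \in K) -> forall x, x \in K -> f x = 0) ->
  trivial K.
Proof.
(* The copies are indexed by the endomorphisms themselves; [classic] supplies the choice structure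
   needed for the sums. *)
move=> sp killK; pose I := {classic {linear M -> M}}.
have [s sE] := linear_fun (@copies_sum_linear I id).
have cL : submod_set [set phi : copies I M | forall i, copies_val phi i \in K].
  split=> [i|phi psi phiK psiK i|a phi phiK i]; first exact: rpred0.
    by apply: rpredD; [exact: phiK | exact: psiK].
  by apply: rpredZ; exact: phiK.
pose L := set_pred cL; pose N := limage s L.
have NK g x : x \in K -> g x \in N.
  move=> Kx; have [phi phiE phiK] := copies_sum_single (id : I -> _) g x.
  apply/set_predP; exists phi; last by rewrite sE.
  by apply/set_predP => j; case: (phiK j) => ->; rewrite ?rpred0.
have Nsum y : y \in N -> exists (r : seq I) (x : I -> M),
    (forall i, x i \in K) /\ y = \sum_(i <- r) i (x i).
  move=> /set_predP[phi /set_predP phiK <-].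
  have /asboolP finphi := copies_valP phi.
  exists (fset_set [set i | copies_val phi i != 0]), (copies_val phi).
  by split=> //; rewrite sE (copies_sumE _ finphi).
suff /trivialP N0 : [set` N] = [set 0] by move=> x Kx; exact/N0/(NK idfun).
apply: sp => [f y /Nsum[r [x [xK ->]]]|].
  rewrite linear_sum; apply: rpred_sum => i _.
  exact: (NK (f \o (i : {linear M -> M}))).
suff killN (f : {linear M -> submod N}) y : y \in N -> f y = 0.
  apply/seteqP; split=> [_ [n [f [k [kN ->]]]]|_ ->] /=.
    by rewrite big1 // => i _; rewrite killN.
  by exists 0%N, (fun=> \0), (fun=> 0); split=> [[]//|]; rewrite big_ord0.
move=> /Nsum[r [x [xK ->]]]; rewrite linear_sum big1 // => g _.
have sN (phi : submod L) : s (submod_val phi) \in N.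
  by apply: mem_limage; exact: submod_valP.
have [p pE] := @corestrict _ _ _ (s \o (val : {linear submod L -> _})) N sN.
have [|||h hE] := M_proj (g := p) f.
- exact: in_sigma_copies.
- exact: in_sigma_submod.
- move=> [z Nz] _; have /set_predP[phi Lphi sphi] := Nz.
  by exists (Submod Lphi) => //; apply: val_inj; rewrite /= pE.
rewrite -hE; apply: val_inj; rewrite /= pE /= -[RHS](linear0 s); congr (s _).
apply: val_inj; apply: funext => i.
(* The coordinate is precomposed with [g] because [killK] can be applied at [x g], which lies in
   [K], while [g (x g)] need not. *)
have [|q qE] := @linear_fun _ M M
    (fun z => copies_val (submod_val (h ((g : {linear M -> M}) z))) i).
  by move=> a z t; rewrite !linearP.
have := killK q _ _ (xK g); rewrite qE; apply=> z; rewrite qE.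
by have /set_predP := submod_valP (h ((g : {linear M -> M}) z)).
Qed.

Definition essential_ker f : Prop := essential_in (lker f) (full M).

(** If [H] avoids the kernel of the composite, [h(H)] avoids that of [f], so [h(H)] is zero and [H]
    lies in the kernel after all. *)
Lemma essential_ker_comp f h : essential_ker f -> essential_ker (f \o h).
Proof.
move=> ef H _ dH; have hH0 : trivial (limage h H).
  apply: ef => [x _|y /mem_lker + /set_predP[x Hx xy]]; first exact: mem_full.
  by rewrite -xy => fhx; rewrite (dH x) ?linear0 //; exact/mem_lker.
move=> x Hx; apply: dH => //; apply/mem_lker.
by move/limage_trivial: hH0 => /= ->; rewrite ?linear0.
Qed.

Lemma essential_ker_le f g :
  {subset lker f <= lker g} -> essential_ker f -> essential_ker g.
Proof. by move=> fg ef H HM dH; apply: ef => // x /fg; exact: dH. Qed.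

(** Lifting [f] to [h : M -> L] puts the preimage under [h] of an essential submodule of [L] inside
    the kernel of [f]. *)
Lemma singular_essential_ker N f : M_singular M (submod N) ->
  (forall x, f x \in N) -> essential_ker f.
Proof.
move=> [K [L [i [p [[sK sL sN] [injI surj_p ker_p ess_i]]]]]] fN H _ dH.
have [f' fE] := corestrict fN; have [h hE] := M_proj f' sL sN surj_p.
have kerE x : p (h x) = 0 -> f x = 0 by rewrite hE -fE => ->.
have /trivialP hH0 : [set` limage h H] = [set 0].
  apply: ess_i; apply/seteqP; split=> [y []|_ ->]; last first.
    by split; [rewrite ker_p /= linear0 | exact: rpred0].
  rewrite ker_p /= => py0 /set_predP[x Hx xy]; rewrite -xy in py0 *.
  by rewrite (dH x) ?linear0 //; exact/mem_lker/kerE.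
move=> x Hx; apply: dH => //; apply/mem_lker/kerE.
by move/limage_trivial: hH0 => ->; rewrite ?linear0.
Qed.

(** The witness is the exact sequence from the kernel of [f] on [K], through [K], to [f(K)]. *)
Lemma essential_ker_singular f K :
  essential_in (meet K (lker f)) K -> M_singular M (submod (limage f K)).
Proof.
move=> eK; have fK (x : submod K) : f (submod_val x) \in limage f K.
  by apply: mem_limage; exact: submod_valP.
have [p pE] := @corestrict _ _ _ (f \o (val : {linear submod K -> M})) _ fK.
exists (submod (lker p)), (submod K), (val : {linear submod (lker p) -> _}), p.
split; first split; try exact: in_sigma_submod.
  apply: (@in_sigma_inj _
    ((val : {linear submod K -> M}) \o (val : {linear submod (lker p) -> _}))).
  exact: (inj_comp val_inj val_inj).
split; first exact: val_inj.
- move=> [y Ny] _; have /set_predP[x Kx xy] := Ny.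
  by exists (Submod Kx) => //; apply: val_inj; rewrite /= pE.
- apply/seteqP; split=> [_ [x _ <-]|x px0] /=.
    exact/mem_lker/submod_valP.
  by have xp : x \in lker p by [exact/mem_lker]; exists (Submod xp).
move=> H kerH; apply/trivialP => x Hx; apply: val_inj => /=.
apply: (eK (limage (val : {linear submod K -> M}) H)); last exact: mem_limage.
  by move=> _ /set_predP[y _ <-]; exact: submod_valP.
move=> z /set_predP[_ /mem_lker fy0] /set_predP[y Hy yE]; rewrite -yE in fy0 *.
have yp : y \in lker p by apply/mem_lker/val_inj; rewrite /= pE.
suff : (range (val : submod (lker p) -> submod K) `&` [set` H]) y.
  by rewrite kerH => ->.
by split=> //; exists (Submod yp).
Qed.

Lemma non_singularP : non_M_singular M M <->
  forall K, M_singular M (submod K) -> trivial K.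
Proof.
split=> [[Z [[_ Zmax] /trivialP Z0]] K /Zmax KZ x Kx|nonsing].
  exact/Z0/KZ.
exists (zero M); split; last by apply/trivialP => x /set_predP.
split=> [|K /nonsing K0 x /K0 ->]; last exact/set_predP.
have sM := in_sigma_self.
(* The zero submodule is M-singular as the quotient of [M] by itself. *)
exists M, M, (idfun : {linear M -> M}), (\0 : {linear M -> submod (zero M)}).
split; first by split=> //; exact: in_sigma_submod.
split=> //.
- move=> [y Ny] _; exists 0 => //; apply: val_inj => /=.
  by have /set_predP := Ny.
- by apply/seteqP; split=> // x _; exists x.
- move=> H HM; apply/trivialP => x Hx.
  suff : (range (idfun : M -> M) `&` [set` H]) x by rewrite HM.
  by split=> //; exists x.
Qed.

End Sigma.

(** * The implications between the three conditions *)

Section Goldie.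
Context {R : pzRingType} {M : lmodType R}.
Implicit Types (f g h : {linear M -> M}) (H K N : submodClosed M).

Hypothesis M_proj : projective_in_sigma M.
Hypothesis M_fud : finite_uniform_dimension M.

Lemma linear_injP f : (forall x, f x = 0 -> x = 0) <-> injective f.
Proof.
split; first exact: raddf_inj.
by move=> injf x fx0; apply: injf; rewrite fx0 linear0.
Qed.

Lemma nonsingular_image0 f K : non_M_singular M M ->
  essential_in (meet K (lker f)) K -> forall x, x \in K -> f x = 0.
Proof.
by move=> /non_singularP ns /essential_ker_singular/ns/limage_trivial.
Qed.

(* The step [g |-> g + f] enlarges [g : M -> N] by a map [f] onto a uniform
   submodule of [N] inside [ker g] on which [f] is injective; the invariant
   [im g /\ ker g = 0] gives [ker (g + f) = ker g /\ ker f], so the submodules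
   [N /\ ker g] strictly decrease. *)
Lemma injective_into_essential N : semiprime M -> non_M_singular M M ->
  essential_in N (full M) -> exists f, (forall x, f x \in N) /\ injective f.
Proof.
move=> sp ns eN; apply: contrapT => noinj.
pose P g := (forall x, g x \in N) /\ (forall x, g (g x) = 0 -> g x = 0).
pose D g := meet N (lker g).
apply: (@fud_descent _ _ M_fud _ P D _ (\0 : {linear M -> M})); last first.
  by split=> x //=; exact: rpred0.
move=> g [gN gg]; have nD : ~ trivial (D g).
  move=> D0; apply: noinj; exists g; split=> //; apply/linear_injP => x gx0.
  apply: (eN (lker g)); [by move=> y _; exact: mem_full| |exact/mem_lker].
  by move=> y Ny gy; apply: D0; apply/set_predP.
have [U [nU uU] UD] := uniform_exists M_fud nD.
have [f [fU fnz]] : exists f, (forall x, f x \in U) /\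
    ~ (forall x, x \in U -> f x = 0).
  apply: contrapT => nof; apply: nU; apply: (semiprime_kill M_proj sp) => f fU.
  by apply: contrapT => fnz; apply: nof; exists f.
have injU x : x \in U -> f x = 0 -> x = 0.
  suff kU0 : trivial (meet U (lker f)).
    by move=> Ux fx0; apply: kU0; apply/set_predP; split=> //; exact/mem_lker.
  (* In the uniform [U] a nonzero kernel is essential, and nonsingularity would force [f] to vanish
     on [U]. *)
  apply: contrapT => nk; apply: fnz; apply: nonsingular_image0 => // H HU dH.
  have [|//|//] := uU _ _ _ HU dH.
  by move=> y /set_predP[].
have [UN Ug] : {subset U <= N} /\ forall x, x \in U -> g x = 0.
  by split=> x /UD /set_predP[? /mem_lker].
have gfE x : g x + f x = 0 -> g x = 0 /\ f x = 0.
  move=> gf0; have gx0 : g x = 0.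
    by apply: gg; rewrite -(addrK (f x) (g x)) gf0 sub0r linearN Ug ?oppr0.
  by split=> //; rewrite gx0 add0r in gf0.
have [k kE] := @linear_fun _ M M (fun x => g x + f x) (linearP (g \+ f)).
exists k, U; split; first split=> x.
- by rewrite kE; apply: rpredD => //; exact: UN.
- rewrite !kE => /gfE[]; rewrite !linearD [g (f x)]Ug // addr0 => /gg gx0.
  by rewrite gx0 linear0 !add0r => /injU->.
split=> //.
- move=> x /set_predP[Nx /mem_lker]; rewrite kE => /gfE[gx0 _].
  by apply/set_predP; split=> //; exact/mem_lker.
- move=> x Ux /set_predP[_ /mem_lker]; rewrite kE => /gfE[_].
  exact: injU.
Qed.

Lemma annihilator_submod (X : set {linear M -> M}) : submod_set (annihilator X).
Proof.
split=> [f _|x y Ax Ay f Xf|a x Ax f Xf] /=; first exact: linear0.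
- by rewrite linearD (Ax f Xf) (Ay f Xf) addr0.
- by rewrite linearZ /= (Ax f Xf) scaler0.
Qed.

(** Let [m >= n] with no nonzero submodule of [A m] avoiding [A n]. Each [f] in [X n] then kills an
    essential part of [A m], hence all of it, and [A m = A n]. So a chain that never stabilises
    feeds [fud_ascent]. *)
Lemma nonsingular_acc : non_M_singular M M -> acc_left_annihilators M.
Proof.
move=> ns A annA incA.
have {annA}/choice[X XE] : forall n, exists X, A n = annihilator X by [].
pose B n : submodClosed M := set_pred (annihilator_submod (X n)).
have memB n x : x \in B n <-> A n x by rewrite XE; exact: set_predP.
have monoA m n : (m <= n)%N -> A m `<=` A n.
  elim: n => [|n IHn]; first by rewrite leqn0 => /eqP ->.
  by rewrite leq_eqVlt ltnS => /predU1P[-> //|/IHn/subset_trans]; apply.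
apply: contrapT => nstab.
apply: (@fud_ascent _ _ M_fud _ (fun _ : nat => True) B _ 0%N) => // n _.
have [m [nm Amn]] : exists m, (n <= m)%N /\ A m <> A n.
  apply: contrapT => nex; apply: nstab; exists n => m nm.
  by apply: contrapT => Amn; apply: nex; exists m.
exists m; apply: contrapT => nH; apply: Amn; apply/seteqP.
split; last exact: monoA.
move=> x Amx; rewrite XE => f Xf /=.
apply: (@nonsingular_image0 f (B m)) => //; last exact/memB.
move=> H HB dH; apply: contrapT => ntH; apply: nH; exists H; split=> //.
split=> //; first by move=> y /memB Any; apply/memB/(monoA n).
move=> y Hy Bny; apply: dH => //; apply/set_predP; split; first exact: HB.
by apply/mem_lker; move/memB: Bny; rewrite XE; exact.
Qed.

(** Without a maximal kernel, dependent choice builds a strictly ascending chain of kernels; each is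
    the annihilator of a singleton. *)
Lemma max_essential_ker f : acc_left_annihilators M ->
    essential_ker f -> (exists x, f x <> 0) ->
  exists g, [/\ essential_ker g, exists x, g x <> 0 &
    forall h, essential_ker h -> (exists x, h x <> 0) ->
      {subset lker g <= lker h} -> {subset lker h <= lker g}].
Proof.
move=> acc ef nf; apply: contrapT => nomax.
pose T := {g : {linear M -> M} | essential_ker g /\ exists x, g x <> 0}.
pose Rel (g h : T) := {subset lker (sval g) <= lker (sval h)} /\
  ~ {subset lker (sval h) <= lker (sval g)}.
have step (g : T) : {h : T | Rel g h}.
  apply: cid; case: g => g [eg ng]; apply: contrapT => nh; apply: nomax.
  exists g; split=> // h eh nzh gh; apply: contrapT => nhg; apply: nh.
  by exists (exist _ h (conj eh nzh)).
have [u [_ uR]] := dependent_choice step (exist _ f (conj ef nf)).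
have [n|n x|n0 stab] := acc (fun n => [set` lker (sval (u n))]).
- exists [set sval (u n)]; apply/seteqP; split=> x /=.
    by move=> /mem_lker ux0 _ ->.
  by move=> /(_ _ erefl) ux0; exact/mem_lker.
- by case: (uR n) => + _; exact.
have [_ []] := uR n0; move=> x xk.
by have := stab n0.+1 (leqnSn _); move=> /seteqP[/(_ x xk)].
Qed.

(* Mewborn-Winton: if [f] has maximal kernel among the nonzero maps with
   essential kernel, such maps [g] satisfy [g f = 0]; by projectivity every
   [M -> im f] is [f h'], hence is such a [g] and kills [im f]. *)
Lemma acc_nonsingular :
  semiprime M -> acc_left_annihilators M -> non_M_singular M M.
Proof.
move=> sp acc; apply/non_singularP => N sN.
suff J0 f : essential_ker f -> forall x, f x = 0.
  apply: (semiprime_kill M_proj sp) => f fN x _; apply: J0.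
  exact: singular_essential_ker fN.
move=> ef0; apply: contrapT => /existsNP nf0.
have [{nf0 ef0}f [ef [x0 nf] fmax]] := max_essential_ker acc ef0 nf0.
have Jf g : essential_ker g -> forall x, g (f x) = 0.
  move=> eg; apply: contrapT => /existsNP ngf.
  (* By maximality a nonzero [g \o f] has the same kernel as [f], so the essential kernel of [g]
     would miss the nonzero image of [f]. *)
  have kgf : {subset lker (g \o f) <= lker f}.
    apply: fmax => //; last first.
      by move=> x /mem_lker fx0; apply/mem_lker; rewrite /= fx0 linear0.
    exact: essential_ker_comp.
  apply: nf; apply: (eg (limage f (full M))).
  - by move=> x _; exact: mem_full.
  - move=> z /mem_lker gz /set_predP[x _ xz]; rewrite -xz in gz *.
    by apply/mem_lker/kgf/mem_lker.
  - exact/mem_limage/mem_full.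
apply: nf; have : trivial (limage f (full M)).
  apply: (semiprime_kill M_proj sp) => g gf _ /set_predP[x _ <-].
  apply: Jf; have [h hE] : exists h, forall x, f (h x) = g x.
    by apply: lift_factor => // y; have /set_predP[z _ zy] := gf y; exists z.
  apply: essential_ker_le (essential_ker_comp (h := h) ef) => y /mem_lker /= fhy.
  by apply/mem_lker; rewrite -hE.
by move/limage_trivial; apply; exact: mem_full.
Qed.

(** * From condition 3 back to condition 1 *)

Section EssentialContainsCopy.

Hypothesis essP : forall N,
  essential_in N (full M) <-> exists f, (forall x, f x \in N) /\ injective f.

Lemma copy_semiprime : semiprime M.
Proof.
move=> K Kinv KK; apply/trivialP => x Kx.
have [C dKC /essP[f [fKC injf]]] := complement_exists M_fud K.
have [g gE] := join_split dKC fKC.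
(* Full invariance puts [f x] in [K]; once [g x] vanishes, [f x] is also in [C]. *)
apply: injf; rewrite linear0; apply: dKC; first exact: Kinv.
have [Kgx] := gE x; suff -> : g x = 0 by rewrite subr0.
have [g' g'E] := corestrict (fun z => (gE z).1).
suff : mprod K K (g x) by rewrite KK.
by exists 1%N, (fun=> g'), (fun=> x); rewrite big_ord1 -g'E.
Qed.

Lemma copy_nonsingular : non_M_singular M M.
Proof.
apply/non_singularP => N sN.
have [C dNC /essP[f [fNC injf]]] := complement_exists M_fud N.
have [g gE] := join_split dNC fNC.
have /essP[h [hg injh]] : essential_in (lker g) (full M).
  by apply: (@singular_essential_ker _ _ M_proj N) => // x; have [] := gE x.
have eC : essential_in C (full M).
  (* On the image of [h] the component [g] of [f] in [N] vanishes, so [f] takes values in [C]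
     there. *)
  apply/essP; exists (f \o h : {linear M -> M}); split; last exact: inj_comp.
  by move=> x /=; have [_] := gE (h x); have /mem_lker -> := hg x; rewrite subr0.
by apply: eC => [x _|x Cx Nx]; [exact: mem_full | exact: dNC].
Qed.

End EssentialContainsCopy.

Lemma submod_embedP N : (exists f : {linear M -> submod N}, injective f) <->
  exists f, (forall x, f x \in N) /\ injective f.
Proof.
split=> [[f injf]|[f [fN injf]]].
  exists ((val : {linear submod N -> M}) \o f); split=> [x|].
    exact: submod_valP.
  exact: inj_comp val_inj injf.
have [g gE] := corestrict fN.
by exists g => x y gxy; apply: injf; rewrite -!gE gxy.
Qed.

End Goldie.

Theorem theorem2p8 (R : pzRingType) (M : lmodType R)
    (M_proj : projective_in_sigma M) (M_fud : finite_uniform_dimension M) :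
  let c1 := semiprime M /\ non_M_singular M M in
  let c2 := semiprime M /\ acc_left_annihilators M in
  let c3 := forall N : submodClosed M,
      essential [set` N] <->
      exists f : {linear M -> submod N}, injective f in
  (c1 <-> c2) /\ (c2 <-> c3).
Proof.
move=> c1 c2 c3.
have c12 : c1 -> c2 by case=> sp ns; split=> //; exact: nonsingular_acc.
have c21 : c2 -> c1 by case=> sp acc; split=> //; exact: acc_nonsingular.
split; split=> //.
- move=> /c21[sp ns] N; rewrite essentialP submod_embedP.
  split; first exact: injective_into_essential.
  move=> [f [fN injf]] H HM dH; apply: (injective_essential M_fud injf) => // x.
  by move=> /set_predP[y _ <-]; exact: dH.
- move=> c3M; apply: c12.
  have essP N : essential_in N (full M) <->
      exists f : {linear M -> M}, (forall x, f x \in N) /\ injective f.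
    by rewrite -essentialP -submod_embedP.
  by split; [exact: copy_semiprime | exact: copy_nonsingular].
Qed.
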